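(* Let $T$ be a maximal torus of $SL_n(\mathbb{C})$, let $1\le r\le n-1$, and let $G_{r,n}$ be the Grassmannian of $r$-dimensional subspaces of $\mathbb{C}^n$. The GIT quotients $T\backslash\backslash(G_{r,n})^{ss}_T(\mathcal{L}_{n\varpi_r})$ and $T\backslash\backslash(G_{n-r,n})^{ss}_T(\mathcal{L}_{n\varpi_{n-r}})$ are isomorphic.
   Context: All varieties are over $\mathbb{C}$. $G_{r,n}=SL_n/P_{\alpha_r}$, where $P_{\alpha_r}$ is the maximal parabolic subgroup associated to the simple root $\alpha_r$, and $\varpi_r$ is the corresponding fundamental weight. $\mathcal{L}_{\varpi_r}$ is the Plücker line bundle (the restriction of $\mathcal{O}(1)$ under $G_{r,n}\subset\mathbb{P}(\wedge^r\mathbb{C}^n)$) with the linearization coming from the natural action of $SL_n$ on $\wedge^r\mathbb{C}^n$, restricted to $T$; $\mathcal{L}_{n\varpi_r}=\mathcal{L}_{\varpi_r}^{\otimes n}$. For a projective variety $X$ with an action of $T$ and a $T$-linearized very ample line bundle $\mathcal{L}$, $X^{ss}_T(\mathcal{L})$ is the open set of semistable points and the GIT quotient $T\backslash\backslash X^{ss}_T(\mathcal{L})$ is its uniform categorical quotient by $T$. *)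

(* Defs.v *)
From HB Require Import structures.
From mathcomp Require Import all_boot all_order all_algebra.
From mathcomp Require Import finmap ring_quotient complex.
From mathcomp Require Import all_classical all_reals.
From mathcomp Require Import topology_structure initial_topology.
From mathcomp Require Import -(notations) mpoly.

Set Implicit Arguments.
Unset Strict Implicit.
Unset Printing Implicit Defensive.

Import Order.TTheory GRing.Theory Num.Theory.

Local Open Scope classical_set_scope.
Local Open Scope ring_scope.

(* Varieties over an algebraically closed field K are handled classically: a  *)
(* variety is its set of K-points with the Zariski topology and a sheaf of    *)
(* K-valued functions.  The sheaf is recorded through its stalks:             *)
(* [regular_at x f] means that f is regular on some neighbourhood of x, and   *)
(* the sections over an open set U are the f that are regular at each point   *)
(* of U (so that the gluing axiom holds by construction).                     *)
Record kspace (K : fieldType) := KSpace {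
  carrier :> topologicalType;
  regular_at : carrier -> set (carrier -> K);
  regular_near : forall x f, regular_at x f -> \forall y \near x, regular_at y f;
  regular_ext : forall x (f g : carrier -> K),
    (\forall y \near x, f y = g y) -> regular_at x f -> regular_at x g;
  regular_cst : forall x (c : K), regular_at x (fun=> c);
  regularB : forall x f g,
    regular_at x f -> regular_at x g -> regular_at x (fun y => f y - g y);
  regularM : forall x f g,
    regular_at x f -> regular_at x g -> regular_at x (fun y => f y * g y);
  regularV : forall x f, regular_at x f -> f x != 0 ->
    (\forall y \near x, f y != 0) /\ regular_at x (fun y => (f y)^-1)
}.
Arguments regular_at {K X} : rename.

Section Morphisms.
Variable K : fieldType.
Implicit Types X Y Z : kspace K.

Definition morphism X Y (h : X -> Y) : Prop :=
  continuous h /\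
  forall x (f : Y -> K), regular_at (h x) f -> regular_at x (f \o h).

Definition isomorphism X Y (h : X -> Y) : Prop :=
  morphism h /\
  exists h' : Y -> X, [/\ morphism h', cancel h h' & cancel h' h].

Definition isomorphic X Y : Prop := exists h : X -> Y, isomorphism h.

Definition regular X (f : X -> K) : Prop := forall x, regular_at x f.

End Morphisms.

(* The structure induced on S by h : S -> X.  If h is injective and its image *)
(* is locally closed in the variety X, this is the reduced induced structure. *)
Section Induced.
Variables (K : fieldType) (S : choiceType) (X : kspace K) (h : S -> X).

Definition induced_carrier : topologicalType := initial_topology h.

Definition induced_regular_at (x : induced_carrier) : set (induced_carrier -> K) :=
  [set g | exists2 f : X -> K, regular_at (h x) f & \forall y \near x, g y = f (h y)].

Lemma near_induced (x : induced_carrier) (P : X -> Prop) :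
  (\forall z \near h x, P z) -> \forall y \near x, P (h y).
Proof. exact: (@initial_continuous S X h x). Qed.

Lemma induced_near x f : induced_regular_at x f ->
  \forall y \near x, induced_regular_at y f.
Proof.
move=> [g /regular_near /near_induced gx /near_join fg]; near=> y.
by exists g; near: y.
Unshelve. all: by end_near. Qed.

Lemma induced_ext x (f g : induced_carrier -> K) :
  (\forall y \near x, f y = g y) ->
  induced_regular_at x f -> induced_regular_at x g.
Proof.
move=> fg [u ux fu]; exists u => //.
by apply: filterS2 fg fu => y <- <-.
Qed.

Lemma induced_cst x (c : K) : induced_regular_at x (fun=> c).
Proof. by exists (fun=> c); [exact: regular_cst|exact: filterE]. Qed.

Lemma inducedB x f g : induced_regular_at x f -> induced_regular_at x g ->
  induced_regular_at x (fun y => f y - g y).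
Proof.
move=> [u ux fu] [v vx gv]; exists (fun y => u y - v y); first exact: regularB.
by apply: filterS2 fu gv => y -> ->.
Qed.

Lemma inducedM x f g : induced_regular_at x f -> induced_regular_at x g ->
  induced_regular_at x (fun y => f y * g y).
Proof.
move=> [u ux fu] [v vx gv]; exists (fun y => u y * v y); first exact: regularM.
by apply: filterS2 fu gv => y -> ->.
Qed.

Lemma inducedV x f : induced_regular_at x f -> f x != 0 ->
  (\forall y \near x, f y != 0) /\ induced_regular_at x (fun y => (f y)^-1).
Proof.
move=> [u ux fu]; rewrite (nbhs_singleton fu) => ux0.
have [/near_induced un0 uV] := regularV ux ux0; split.
  by apply: filterS2 un0 fu => y ? ->.
by exists (fun y => (u y)^-1) => //; apply: filterS fu => y ->.
Qed.

Definition induced : kspace K :=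
  KSpace induced_near induced_ext induced_cst inducedB inducedM inducedV.

End Induced.

Definition sub_space (K : fieldType) (X : kspace K) (A : set X) : kspace K :=
  @induced K A X val.

(* A matrix is viewed as the list [mxvec A] of its entries. *)
Section Polynomials.
Variables (K : fieldType) (m n : nat).

Definition peval (p : mpoly (m * n) K) (A : 'M[K]_(m, n)) : K :=
  meval (fun k => mxvec A 0 k) p.

Lemma pevalB p q A : peval (p - q) A = peval p A - peval q A.
Proof. exact: mevalB. Qed.

Lemma pevalM p q A : peval (p * q) A = peval p A * peval q A.
Proof. exact: mevalM. Qed.

Lemma pevalC c A : peval (mpolyC _ c) A = c.
Proof. exact: mevalC. Qed.

End Polynomials.

Notation homogeneous d := (ishomog1 d mdeg).

(* Functions that are locally quotients p / q, with p and q both satisfying   *)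
(* [Q d] for a common d; the evaluation point is [ev x].                      *)
Section Fractions.
Variables (K : fieldType) (m n : nat) (S : topologicalType) (ev : S -> 'M[K]_(m, n)).
Local Notation P := (mpoly (m * n) K).
Variable Q : nat -> P -> Prop.

Definition fraction_at (x : S) : set (S -> K) :=
  [set f | exists d (p q : P), [/\ Q d p, Q d q, peval q (ev x) != 0 &
     \forall y \near x, f y = peval p (ev y) / peval q (ev y)]].

Hypothesis QB : forall d p q, Q d p -> Q d q -> Q d (p - q).
Hypothesis QM : forall d e p q, Q d p -> Q e q -> Q (d + e)%N (p * q).
Hypothesis Q0 : forall c, Q 0%N (mpolyC _ c).
Hypothesis ev_open : forall d q, Q d q -> open [set x | peval q (ev x) != 0].

Lemma peval_near d q x : Q d q -> peval q (ev x) != 0 ->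
  \forall y \near x, peval q (ev y) != 0.
Proof. by move=> Qq qx; apply: open_nbhs_nbhs; split; [exact: ev_open Qq|]. Qed.

Lemma fraction_near x f : fraction_at x f -> \forall y \near x, fraction_at y f.
Proof.
move=> [d [p [q [Qp Qq /(peval_near Qq) qx /near_join fx]]]].
by apply: filterS2 qx fx => y qy fy; exists d, p, q.
Qed.

Lemma fraction_ext x (f g : S -> K) : (\forall y \near x, f y = g y) ->
  fraction_at x f -> fraction_at x g.
Proof.
move=> fg [d [p [q [Qp Qq qx fx]]]]; exists d, p, q; split=> //.
by apply: filterS2 fg fx => y <- <-.
Qed.

Lemma fraction_cst x (c : K) : fraction_at x (fun=> c).
Proof.
exists 0%N, (mpolyC _ c), (mpolyC _ 1); split=> //.
  by rewrite pevalC oner_eq0.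
by apply: filterE => y; rewrite !pevalC divr1.
Qed.

Lemma fractionB x f g : fraction_at x f -> fraction_at x g ->
  fraction_at x (fun y => f y - g y).
Proof.
move=> [d [p [q [Qp Qq qx fx]]]] [e [r [s [Qr Qs sx gx]]]].
exists (d + e)%N, (p * s - r * q), (q * s); split.
- by apply: QB; [exact: QM|rewrite addnC; exact: QM].
- exact: QM.
- by rewrite pevalM mulf_neq0.
have qn := peval_near Qq qx; have sn := peval_near Qs sx.
near=> y; have -> : f y = peval p (ev y) / peval q (ev y) by near: y.
have -> : g y = peval r (ev y) / peval s (ev y) by near: y.
rewrite pevalB !pevalM -mulNr addf_div ?mulNr //; near: y.
  exact: qn.
exact: sn.
Unshelve. all: by end_near. Qed.

Lemma fractionM x f g : fraction_at x f -> fraction_at x g ->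
  fraction_at x (fun y => f y * g y).
Proof.
move=> [d [p [q [Qp Qq qx fx]]]] [e [r [s [Qr Qs sx gx]]]].
exists (d + e)%N, (p * r), (q * s); split; [exact: QM|exact: QM| |].
  by rewrite pevalM mulf_neq0.
by apply: filterS2 fx gx => y -> ->; rewrite !pevalM mulf_div.
Qed.

Lemma fractionV x f : fraction_at x f -> f x != 0 ->
  (\forall y \near x, f y != 0) /\ fraction_at x (fun y => (f y)^-1).
Proof.
move=> [d [p [q [Qp Qq qx fx]]]]; rewrite (nbhs_singleton fx) => pqx.
have px : peval p (ev x) != 0 by apply: contraNneq pqx => ->; rewrite mul0r.
split; last first.
  by exists d, q, p; split=> //; apply: filterS fx => y ->; rewrite invf_div.
apply: filterS3 fx (peval_near Qp px) (peval_near Qq qx) => y -> py qy.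
by rewrite mulf_neq0 // invr_eq0.
Qed.

Definition fraction_space : kspace K :=
  KSpace fraction_near fraction_ext fraction_cst fractionB fractionM fractionV.

End Fractions.

(* Affine space, with the matrices of a given size as points. *)
Definition aff_point (K : fieldType) (m n : nat) : Type := 'M[K]_(m, n).

Section AffineSpace.
Variables (K : fieldType) (m n : nat).
Local Notation A := (aff_point K m n).
Local Notation P := (mpoly (m * n) K).

Definition aff_mx (a : A) : 'M[K]_(m, n) := a.

Definition aff_basic_open (p : P) : set A := [set a | peval p (aff_mx a) != 0].

HB.instance Definition _ := Choice.on A.
HB.instance Definition _ := isSubBaseTopological.Build A (range aff_basic_open) id.

Lemma aff_ev_open (d : nat) (q : P) : True -> open [set x : A | peval q (aff_mx x) != 0].
Proof.
move=> _; exists [set aff_basic_open q]; last by rewrite bigcup_set1.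
move=> _ ->; exists [fset aff_basic_open q]%fset.
  by move=> B; rewrite in_fset1 => /eqP ->; apply/mem_set; exists q.
by rewrite set_fset1 bigcap_set1.
Qed.

Definition aff : kspace K :=
  fraction_space (ev := aff_mx) (Q := fun _ _ => True)
    (fun _ _ _ _ _ => I) (fun _ _ _ _ _ _ => I) (fun _ => I) aff_ev_open.

End AffineSpace.

(* The projective space of lines in 'cV[K]_N; [vpick L] is a nonzero vector   *)
(* of the line L, i.e. a choice of homogeneous coordinates.                   *)
Definition proj_point (K : fieldType) (N : nat) : Type :=
  {L : {vspace 'cV[K]_N} | \dim L == 1%N}.

Section ProjectiveSpace.
Variables (K : fieldType) (N : nat).
Local Notation PP := (proj_point K N).
Local Notation P := (mpoly (N * 1) K).

Definition hcoord (L : PP) : 'cV[K]_N := vpick (val L).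

Definition proj_basic_open (p : P) : set PP := [set L | peval p (hcoord L) != 0].

HB.instance Definition _ := Choice.on PP.
HB.instance Definition _ := isSubBaseTopological.Build PP
  [set proj_basic_open p | p in [set p | exists d, p \is homogeneous d]] id.

Lemma proj_ev_open (d : nat) (q : P) : q \is homogeneous d ->
  open [set x : PP | peval q (hcoord x) != 0].
Proof.
move=> hq; exists [set proj_basic_open q]; last by rewrite bigcup_set1.
move=> _ ->; exists [fset proj_basic_open q]%fset.
  by move=> B; rewrite in_fset1 => /eqP ->; apply/mem_set; exists q => //; exists d.
by rewrite set_fset1 bigcap_set1.
Qed.

Lemma homogeneousB d (p q : P) : p \is homogeneous d -> q \is homogeneous d ->
  p - q \is homogeneous d.
Proof. by move=> hp hq; rewrite rpredB. Qed.

Lemma homogeneousM d e (p q : P) : p \is homogeneous d -> q \is homogeneous e ->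
  p * q \is homogeneous (d + e).
Proof. exact: dhomogM. Qed.

Lemma homogeneousC (c : K) : mpolyC (N * 1) c \is homogeneous 0.
Proof. by rewrite -alg_mpolyC rpredZ // dhomog1. Qed.

Definition proj : kspace K :=
  fraction_space (ev := hcoord) (Q := fun d p => p \is homogeneous d)
    homogeneousB homogeneousM homogeneousC proj_ev_open.

End ProjectiveSpace.

Section Varieties.
Variable K : fieldType.
Implicit Types X Y Z : kspace K.

Definition affine_variety X : Prop :=
  exists N (A : set (aff K N 1)), closed A /\ isomorphic X (sub_space A).

Definition prevariety X : Prop :=
  exists (J : finType) (U : J -> set X),
    (forall j, open (U j) /\ affine_variety (sub_space (U j))) /\
    \bigcup_j U j = setT.

Definition separated X : Prop :=
  forall Z (f g : Z -> X), prevariety Z -> morphism f -> morphism g ->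
    closed [set z | f z = g z].

(* Varieties are not required to be irreducible. *)
Definition variety X : Prop := prevariety X /\ separated X.

(* P is the fibre product of h1 and h2 in the category of varieties. *)
Definition fibre_product X1 X2 Y (h1 : X1 -> Y) (h2 : X2 -> Y)
    (P : kspace K) (p1 : P -> X1) (p2 : P -> X2) : Prop :=
  [/\ variety P, morphism p1, morphism p2, h1 \o p1 = h2 \o p2 &
      forall Z (q1 : Z -> X1) (q2 : Z -> X2), variety Z ->
        morphism q1 -> morphism q2 -> h1 \o q1 = h2 \o q2 ->
        exists! q : Z -> P, [/\ morphism q, p1 \o q = q1 & p2 \o q = q2]].

End Varieties.

Section Stalk.
Variables (K : fieldType) (X : kspace K) (x : X).

Definition regular_pred : {pred X -> K} := fun f => `[< regular_at x f >].

Lemma regular_predP f : f \in regular_pred <-> regular_at x f.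
Proof. by rewrite unfold_in; split => /asboolP. Qed.

Lemma regular_subring : subring_closed regular_pred.
Proof.
split=> [|f g /regular_predP rf /regular_predP rg|f g /regular_predP rf /regular_predP rg];
  apply/regular_predP; [exact: regular_cst|exact: regularB|exact: regularM].
Qed.

HB.instance Definition _ := GRing.isSubringClosed.Build (X -> K) regular_pred
  regular_subring.

Definition regular_fun := {f : X -> K | f \in regular_pred}.

HB.instance Definition _ := SubChoice.on regular_fun.
HB.instance Definition _ := GRing.SubChoice_isSubComPzRing.Build (X -> K) regular_pred
  regular_fun regular_subring.

Lemma regular_fun1_neq0 : 1 != 0 :> regular_fun.
Proof.
by apply/eqP => /(congr1 (fun f => val f x)) /eqP; rewrite oner_eq0.
Qed.

HB.instance Definition _ :=
  GRing.PzSemiRing_isNonZero.Build regular_fun regular_fun1_neq0.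

Definition null_germ : {pred regular_fun} :=
  fun f => `[< \forall y \near x, val f y = 0 >].

Lemma null_germ_ideal : idealr_closed null_germ.
Proof.
split=> [||a f g /asboolP f0 /asboolP g0].
- by apply/asboolP; exact: filterE.
- by apply/asboolP => /nbhs_singleton /eqP; rewrite oner_eq0.
- apply/asboolP; apply: filterS2 f0 g0 => y fy gy.
  have -> : val (a * f + g) y = val a y * val f y + val g y by [].
  by rewrite fy gy mulr0 addr0.
Qed.

HB.instance Definition _ := isIdealr.Build regular_fun null_germ null_germ_ideal.

Definition local_ring : comNzRingType := Quotient.quot null_germ.

Definition germ (f : regular_fun) : local_ring := (\pi_(Quotient.quot null_germ) f)%qT.

End Stalk.

(* Flatness of a ring morphism phi : A -> B, through tensor products N (x)_A B *)
(* given by their universal property.                                         *)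
Section Flat.
Variables (A B : comPzRingType) (phi : {rmorphism A -> B}).

Definition balanced (N : lmodType A) (M : zmodType) (tau : N -> B -> M) : Prop :=
  [/\ forall x y b, tau (x + y) b = tau x b + tau y b,
      forall x b c, tau x (b + c) = tau x b + tau x c &
      forall a x b, tau (a *: x) b = tau x (phi a * b)].

Definition is_tensor (N : lmodType A) (M : zmodType) (tau : N -> B -> M) : Prop :=
  balanced tau /\
  forall (M' : zmodType) (sigma : N -> B -> M'), balanced sigma ->
    exists h : {additive M -> M'}, (forall x b, h (tau x b) = sigma x b) /\
      forall h' : {additive M -> M'},
        (forall x b, h' (tau x b) = sigma x b) -> h' =1 h.

Definition flat : Prop :=
  forall (N N' : lmodType A) (i : {linear N -> N'}), injective i ->
  forall (M M' : zmodType) (tau : N -> B -> M) (tau' : N' -> B -> M'),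
    is_tensor tau -> is_tensor tau' ->
  forall h : {additive M -> M'},
    (forall x b, h (tau x b) = tau' (i x) b) -> injective h.

End Flat.

(* phi below is the morphism induced by h on the local rings. *)
Definition flat_morphism (K : fieldType) (Y' Y : kspace K) (h : Y' -> Y) : Prop :=
  morphism h /\
  forall (y : Y') (phi : {rmorphism local_ring (h y) -> local_ring y}),
    (forall (f : regular_fun (h y)) (g : regular_fun y),
       val g = val f \o h -> phi (germ f) = germ g) ->
    flat phi.

(* Quotients of X by a group, which enters through its orbit relation:        *)
(* [orb x y] means that x and y are in the same orbit.                        *)
Section Quotients.
Variable K : fieldType.

Definition categorical_quotient (X : kspace K) (orb : X -> X -> Prop)
    (Y : kspace K) (pi : X -> Y) : Prop :=
  [/\ morphism pi, forall x y, orb x y -> pi x = pi y &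
      forall (Z : kspace K) (f : X -> Z), variety Z -> morphism f ->
        (forall x y, orb x y -> f x = f y) ->
        exists! g : Y -> Z, morphism g /\ g \o pi = f].

(* In a base change P of X along h : Y' -> Y the group acts on the factor X.  *)
Definition uniform_categorical_quotient (X : kspace K) (orb : X -> X -> Prop)
    (Y : kspace K) (pi : X -> Y) : Prop :=
  categorical_quotient orb pi /\
  forall (Y' : kspace K) (h : Y' -> Y), variety Y' -> flat_morphism h ->
  forall (P : kspace K) (p : P -> X) (pi' : P -> Y'), fibre_product pi h p pi' ->
    categorical_quotient (fun z w => orb (p z) (p w) /\ pi' z = pi' w) pi'.

End Quotients.

Section Tori.
Variables (K : fieldType) (n : nat).

Definition SL : set 'M[K]_n := [set g | \det g = 1].

Definition subgroup_SL (T : set 'M[K]_n) : Prop :=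
  [/\ T `<=` SL, T 1%:M, forall g h, T g -> T h -> T (g *m h) &
      forall g, T g -> T (invmx g)].

(* The variety underlying the algebraic group G_m^k. *)
Definition Gm (k : nat) : kspace K :=
  sub_space [set a : aff K k 1 | forall i, aff_mx a i 0 != 0].

Definition matrix_space (T : set 'M[K]_n) : kspace K :=
  @sub_space K (aff K n n) T.

Definition torus (T : set 'M[K]_n) : Prop :=
  [/\ subgroup_SL T, closed (T : set (aff K n n)) &
      exists k (phi : Gm k -> matrix_space T), isomorphism phi /\
        forall u v w : Gm k,
          (forall i, aff_mx (val w) i 0 = aff_mx (val u) i 0 * aff_mx (val v) i 0) ->
          val (phi w) = val (phi u) *m val (phi v)].

Definition maximal_torus (T : set 'M[K]_n) : Prop :=
  torus T /\ forall T', torus T' -> T `<=` T' -> T' = T.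

End Tori.

(* The r-subsets of {0, ..., n-1}; they index the basis of wedge^r K^n.       *)
Definition rsubset (n r : nat) : finType := {A : {set 'I_n} | #|A| == r}.

Definition rsubset_nth (n r : nat) (A : rsubset n r) (i : 'I_r) : 'I_n :=
  enum_val (cast_ord (esym (eqP (valP A))) i).

Section Grassmannian.
Variables (K : fieldType) (n r : nat).

Definition wedge_dim : nat := #|rsubset n r|.
Local Notation wedge := 'cV[K]_wedge_dim.

(* v_1 /\ ... /\ v_r, where the v_j are the columns of M. *)
Definition wedge_cols (M : 'M[K]_(n, r)) : wedge :=
  \col_i \det (rowsub (rsubset_nth (enum_val i)) M).

(* The natural action of g on wedge^r K^n, i.e. the r-th compound matrix. *)
Definition wedge_act (g : 'M[K]_n) (w : wedge) : wedge :=
  (\matrix_(i, j) \det (mxsub (rsubset_nth (enum_val i)) (rsubset_nth (enum_val j)) g))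
    *m w.

Definition gr_point : Type := {V : {vspace 'cV[K]_n} | \dim V == r}.
HB.instance Definition _ := Choice.on gr_point.

Definition gr_basis (V : gr_point) : 'M[K]_(n, r) :=
  \matrix_(i, j) (vbasis (val V))`_j i 0.

Lemma gr_basis_row_full V : row_full (gr_basis V).
Proof.
have e : \dim (val V) = r by exact/eqP/(valP V).
rewrite /row_full -mxrank_tr; apply: inj_row_free => v /rowP v0.
have /freeP free_b := basis_free (vbasisP (val V)).
suff k0 i : v 0 (cast_ord e i) = 0.
  by apply/rowP => j; rewrite mxE -(cast_ordKV e j) k0.
move: i; apply: free_b; apply/colP => l.
have := v0 l; rewrite !mxE => <-; rewrite summxE.
rewrite (reindex (cast_ord e)) /=; last first.
  by exists (cast_ord (esym e)) => j _; rewrite ?cast_ordK ?cast_ordKV.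
by apply: eq_bigr => j _; rewrite !mxE.
Qed.

Lemma rsubset_nth_surj (A : rsubset n r) x : x \in val A -> exists i, rsubset_nth A i = x.
Proof.
move=> xA; exists (cast_ord (eqP (valP A)) (enum_rank_in xA x)).
by rewrite /rsubset_nth cast_ord_comp cast_ord_id enum_rankK_in.
Qed.

Lemma wedge_cols_neq0 (M : 'M[K]_(n, r)) : row_full M -> wedge_cols M != 0.
Proof.
move=> fullM; pose f := fullrankfun fullM.
have cardA : #|[set f i | i : 'I_r]%SET| == r.
  by rewrite card_imset ?card_ord //; exact: fullrankfun_inj.
pose A : rsubset n r := exist (fun B : {set 'I_n} => #|B| == r) _ cardA.
suff unitA : rowsub (rsubset_nth A) M \in unitmx.
  apply/eqP => /colP /(_ (enum_rank A)); rewrite !mxE enum_rankK => /eqP.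
  by apply/negP; rewrite -unitfE -unitmxE.
rewrite -row_full_unit -col_leq_rank -{1}(mxrank_fullrowsub fullM) mxrankS //.
apply/row_subP => i.
have [k Ak] : exists k, rsubset_nth A k = f i.
  by apply: rsubset_nth_surj; apply: imset_f.
have -> : row i (rowsub (fullrankfun fullM) M) = row k (rowsub (rsubset_nth A) M).
  by apply/rowP => j; rewrite !mxE Ak.
exact: row_sub.
Qed.

Lemma dim_plucker V : \dim <[wedge_cols (gr_basis V)]>%VS == 1%N.
Proof. by rewrite dim_vline wedge_cols_neq0 // gr_basis_row_full. Qed.

(* The line wedge^r V in wedge^r K^n. *)
Definition plucker (V : gr_point) : proj K wedge_dim :=
  exist (fun L : {vspace wedge} => \dim L == 1%N) _ (dim_plucker V).

Definition Gr : kspace K := @induced K gr_point (proj K wedge_dim) plucker.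

Definition gr_act (g : 'M[K]_n) (V : {vspace 'cV[K]_n}) : {vspace 'cV[K]_n} :=
  (linfun (mulmx g) @: V)%VS.

Definition same_orbit (T : set 'M[K]_n) (V W : Gr) : Prop :=
  exists2 g, T g & val W = gr_act g (val V).

(* The cone over the Grassmannian without its vertex. *)
Definition on_plucker_line (w : wedge) (V : Gr) : Prop :=
  w != 0 /\ w \in val (plucker V).

Definition cone : set (aff K wedge_dim 1) :=
  [set w | exists V, on_plucker_line (aff_mx w) V].

(* Global sections of the k-th power of the Pluecker line bundle O(1): the    *)
(* complement of the zero section in O(-1) is the cone without its vertex, so *)
(* that sections of O(k) are functions on it, homogeneous of degree k.        *)
Definition line_section (k : nat) (s : sub_space cone -> K) : Prop :=
  regular s /\
  forall (c : K) (v w : sub_space cone), c != 0 ->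
    aff_mx (val w) = c *: aff_mx (val v) -> s w = c ^+ k * s v.

(* Invariance for the linearization given by the action on wedge^r K^n. *)
Definition invariant_section (T : set 'M[K]_n) (s : sub_space cone -> K) : Prop :=
  forall g (v w : sub_space cone), T g ->
    aff_mx (val w) = wedge_act g (aff_mx (val v)) -> s w = s v.

(* Semistable points for the m-th power of the Pluecker line bundle.  The     *)
(* locus where s <> 0 is affine, because this line bundle is ample.           *)
Definition semistable (T : set 'M[K]_n) (m : nat) : set Gr :=
  [set V | exists d (s : sub_space cone -> K),
     [/\ (0 < d)%N, line_section (d * m) s, invariant_section T s &
         exists w : sub_space cone, on_plucker_line (aff_mx (val w)) V /\ s w != 0]].

(* Y is the GIT quotient of Gr by T for the m-th power of the Pluecker line   *)
(* bundle; it is determined up to a unique isomorphism.                       *)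
Definition GIT_quotient (T : set 'M[K]_n) (m : nat) (Y : kspace K) : Prop :=
  variety Y /\ exists pi : sub_space (semistable T m) -> Y,
    uniform_categorical_quotient
      (fun V W : sub_space (semistable T m) => same_orbit T (val V) (val W)) pi.

End Grassmannian.
Arguments GIT_quotient {K n} r T m Y.

(* Main.v *)
(* Let b be a symmetric nondegenerate bilinear form on K^n for which every     *)
(* element of T is self-adjoint; a torus is diagonalisable, so such a form is  *)
(* obtained from the standard one by a base change.  The map V |-> V^perp from *)
(* G(r, n) to G(n - r, n) sends gV to g^-1 V^perp for g in T, hence T-orbits   *)
(* to T-orbits.  By Jacobi's identity for complementary minors it is induced,  *)
(* in Pluecker coordinates, by a linear isomorphism psi (a Hodge star), and    *)
(* psi intertwines g with g^-1 on decomposable vectors because det g = 1.  So  *)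
(* composition with psi matches the invariant sections on both sides, V^perp   *)
(* is semistable iff V is, and the universal property of categorical quotients *)
(* gives the isomorphism.                                                      *)

From mathcomp Require Import all_boot all_order all_algebra perm.
From mathcomp Require Import separable cyclotomic.
From mathcomp Require Import complex.
From mathcomp Require Import all_classical all_reals.
From mathcomp Require Import finmap.
From mathcomp Require Import topology_structure.
From mathcomp Require Import -(notations) mpoly.
Require Import Defs.

Set Implicit Arguments.
Unset Strict Implicit.
Unset Printing Implicit Defensive.

Import Order.TTheory GRing.Theory Num.Theory.

Local Open Scope ring_scope.

(** * Compound matrices and complementary minors *)

Section Compound.
Variables (K : fieldType) (n r : nat).
Implicit Types (A B : rsubset n r).

(** A torus in SL_n is diagonalizable, so some symmetric invertible [Q] satisfies
    [g^T *m Q = Q *m g] for all g in T ([torus_symmetric]). Taking orthogonal complements for the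
    form x^T Q y identifies G(r, n) with G(n - r, n) and sends T-orbits to T-orbits, g becoming g^-1
    ([ortho_act]).

    In Plücker coordinates this bijection is the restriction of an invertible matrix, a Hodge star
    corrected by a compound of [invmx Q]; this rests on the identity between complementary minors
    ([wedge_cols_hodge], [plucker_theta]). Hence it is an isomorphism of varieties. The matrix
    exchanges the actions of g and g^-1 on the cones ([psi_act]), where det g = 1 removes a
    determinant character. So invariant sections correspond in the same degree, semistable loci
    match ([semistable_linear]), and uniqueness of categorical quotients concludes
    ([categorical_quotient_isomorphic]). *)

Lemma rsubset_nth_inj A : injective (rsubset_nth A).
Proof. by move=> i j /enum_val_inj /cast_ord_inj. Qed.

Lemma rsubset_nth_mem A i : rsubset_nth A i \in val A.
Proof. exact: enum_valP. Qed.

Lemma det_mulmx_sum_ffun (A : 'M[K]_(r, n)) (B : 'M[K]_(n, r)) :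
  \det (A *m B) =
    \sum_(f : {ffun 'I_r -> 'I_n}) (\prod_i A i (f i)) * \det (rowsub f B).
Proof.
transitivity (\sum_(s : 'S_r) \sum_(f : {ffun 'I_r -> 'I_n})
    (\prod_i A i (f i)) * ((-1) ^+ s * \prod_i B (f i) (s i))).
  apply: eq_bigr => s _.
  under eq_bigr do rewrite mxE.
  rewrite bigA_distr_bigA mulr_sumr; apply: eq_bigr => f _.
  by rewrite big_split mulrCA.
rewrite exchange_big; apply: eq_bigr => f _; rewrite -mulr_sumr; congr (_ * _).
by apply: eq_bigr => s _; congr (_ * _); apply: eq_bigr => i _; rewrite mxE.
Qed.

Lemma det_rowsub_eq0 (f : 'I_r -> 'I_n) (B : 'M[K]_(n, r)) :
  ~~ injectiveb f -> \det (rowsub f B) = 0.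
Proof.
move=> /injectivePn [i [j ij fij]].
by apply: (determinant_alternate ij) => k; rewrite !mxE fij.
Qed.

Lemma det_rowsub_perm (s : 'S_r) (f : 'I_r -> 'I_n) (B : 'M[K]_(n, r)) :
  \det (rowsub (f \o s) B) = (-1) ^+ s * \det (rowsub f B).
Proof.
rewrite -det_perm -det_mulmx -row_permE; congr (\det _).
by apply/matrixP => i j; rewrite !mxE.
Qed.

(** In the expansion over all maps f, a repeated value gives a minor with two equal rows. An
    injective f is the enumeration of its image composed with a unique permutation, and summing over
    the permutations rebuilds the minor of [A]. *)
Lemma Cauchy_Binet (A : 'M[K]_(r, n)) (B : 'M[K]_(n, r)) :
  \det (A *m B) =
    \sum_C \det (colsub (rsubset_nth C) A) * \det (rowsub (rsubset_nth C) B).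
Proof.
pose h (p : rsubset n r * 'S_r) := [ffun i => rsubset_nth p.1 (p.2 i)].
have h_img p : [set h p i | i in 'I_r]%SET = val p.1.
  apply/setP => x; apply/imsetP/idP => [[i _ ->]|].
    by rewrite ffunE rsubset_nth_mem.
  move=> /rsubset_nth_surj [i <-]; exists ((p.2)^-1%g i) => //.
  by rewrite ffunE permKV.
have h_inj : injective h.
  move=> [C s] [D t] /[dup] hst.
  move=> /(congr1 (fun f : {ffun _} => [set f i | i in 'I_r]%SET)).
  rewrite !h_img.
  move=> /val_inj /= CD; congr (_, _) => //; apply/permP => i.
  by move/ffunP/(_ i): hst; rewrite !ffunE /= CD => /rsubset_nth_inj.
have h_onto (f : {ffun 'I_r -> 'I_n}) : injectiveb f = (f \in [set h p | p : _]%SET).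
  apply/injectiveP/imsetP => [f_inj|[p _ ->] i j]; last first.
    by rewrite !ffunE => /rsubset_nth_inj /perm_inj.
  have cardC : #|[set f i | i in 'I_r]%SET| == r by rewrite card_imset // card_ord.
  pose C : rsubset n r := exist (fun B : {set 'I_n} => #|B| == r) _ cardC.
  have /fin_all_exists [g fg] i : exists k, rsubset_nth C k = f i.
    by apply: rsubset_nth_surj; apply: imset_f.
  have g_inj : injective g by move=> i j gij; apply: f_inj; rewrite -!fg gij.
  by exists (C, perm g_inj) => //; apply/ffunP => i; rewrite ffunE permE /= fg.
rewrite det_mulmx_sum_ffun (bigID (fun f : {ffun _} => injectiveb f)) /=.
rewrite [X in _ + X]big1 ?addr0; last first.
  by move=> f /det_rowsub_eq0 ->; rewrite mulr0.
rewrite (eq_bigl _ _ h_onto) big_imset; last by move=> p q _ _ /h_inj.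
transitivity (\sum_C \sum_(s : 'S_r)
    (\prod_i A i (h (C, s) i)) * \det (rowsub (h (C, s)) B)).
  by rewrite pair_bigA; apply: eq_big => [p|[C s] _] /=; rewrite ?inE.
apply: eq_bigr => C _; rewrite [X in X * _]/determinant mulr_suml.
apply: eq_bigr => s _.
have -> : rowsub (h (C, s)) B = rowsub (rsubset_nth C \o s) B.
  by apply/matrixP => i j; rewrite !mxE ffunE.
rewrite det_rowsub_perm mulrCA mulrA; congr (_ * _ * _).
by apply: eq_bigr => i _; rewrite mxE ffunE.
Qed.

(** The matrix of the r-th exterior power of g; [wedge_act] is multiplication by it. *)
Definition compound (g : 'M[K]_n) : 'M[K]_(wedge_dim n r) :=
  \matrix_(i, j)
    \det (mxsub (rsubset_nth (enum_val i)) (rsubset_nth (enum_val j)) g).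

Lemma compoundM g h : compound (g *m h) = compound g *m compound h.
Proof.
apply/matrixP => i j; rewrite !mxE.
have -> : mxsub (rsubset_nth (enum_val i)) (rsubset_nth (enum_val j)) (g *m h) =
    rowsub (rsubset_nth (enum_val i)) g *m colsub (rsubset_nth (enum_val j)) h.
  by apply/matrixP => a b; rewrite !mxE; apply: eq_bigr => c _; rewrite !mxE.
rewrite Cauchy_Binet (reindex _ (onW_bij _ (@enum_val_bij (rsubset n r)))) /=.
apply: eq_bigr => k _; rewrite !mxE.
by congr (_ * _); congr (\det _); apply/matrixP => a b; rewrite !mxE.
Qed.

Lemma compound1 : compound 1%:M = 1%:M.
Proof.
apply/matrixP => i j; rewrite !mxE.
have [->|ij] := eqVneq i j.
  rewrite -[RHS](det1 _ r); congr (\det _); apply/matrixP => a b.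
  by rewrite !mxE (inj_eq (@rsubset_nth_inj _)).
have /subsetPn [x xi xj] : ~~ (val (enum_val i) \subset val (enum_val j)).
  apply: contra ij => sij; rewrite -(inj_eq enum_val_inj) -val_eqE eqEcard sij.
  by rewrite (eqP (valP (enum_val i))) (eqP (valP (enum_val j))) /=.
have [a ax] := rsubset_nth_surj xi.
rewrite (expand_det_row _ a) big1 // => b _; rewrite !mxE ax.
case: eqP => [xb|_]; last by rewrite mul0r.
by move: xj; rewrite xb rsubset_nth_mem.
Qed.

Lemma wedge_colsM g (M : 'M[K]_(n, r)) :
  wedge_cols (g *m M) = compound g *m wedge_cols M.
Proof.
apply/colP => i; rewrite !mxE.
have -> : rowsub (rsubset_nth (enum_val i)) (g *m M) =
    rowsub (rsubset_nth (enum_val i)) g *m M.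
  by apply/matrixP => a b; rewrite !mxE; apply: eq_bigr => c _; rewrite !mxE.
rewrite Cauchy_Binet (reindex _ (onW_bij _ (@enum_val_bij (rsubset n r)))) /=.
apply: eq_bigr => k _; rewrite !mxE.
by congr (_ * _); congr (\det _); apply/matrixP => a b; rewrite !mxE.
Qed.

End Compound.

(** * The Hodge star in Plücker coordinates *)

Section Hodge.
Variables (K : fieldType) (r s : nat).
Local Notation n := (r + s)%N.

Lemma card_compl (p q m : nat) (A : rsubset m p) :
  (p + q = m)%N -> #|~: val A|%SET == q.
Proof.
by move=> pq; rewrite cardsCs finset.setCK card_ord (eqP (valP A)) -pq addKn.
Qed.

Definition compl_rsubset (p q m : nat) (e : (p + q = m)%N) (A : rsubset m p) :
    rsubset m q :=
  exist (fun B : {set 'I_m} => #|B| == q) _ (card_compl A e).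

Lemma compl_rsubsetK p q m (e : (p + q = m)%N) (f : (q + p = m)%N) :
  cancel (compl_rsubset e) (compl_rsubset f).
Proof. by move=> A; apply: val_inj; rewrite /= finset.setCK. Qed.

Definition coord_cols p m (A : rsubset m p) : 'M[K]_(m, p) :=
  colsub (rsubset_nth A) 1%:M.

Lemma coord_cols_tr p m q (A : rsubset m p) (M : 'M[K]_(m, q)) :
  (coord_cols A)^T *m M = rowsub (rsubset_nth A) M.
Proof.
by rewrite trmx_mxsub trmx1 mul_rowsub_mx mul1mx.
Qed.

Lemma coord_colsK p m (A : rsubset m p) : (coord_cols A)^T *m coord_cols A = 1%:M.
Proof.
rewrite coord_cols_tr; apply/matrixP => i j.
by rewrite !mxE (inj_eq (@rsubset_nth_inj _ _ _)).
Qed.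

Lemma coord_cols_disjoint p q m (A : rsubset m p) (B : rsubset m q) :
  [disjoint val A & val B] -> (coord_cols A)^T *m coord_cols B = 0.
Proof.
move=> AB; rewrite coord_cols_tr; apply/matrixP => i j; rewrite !mxE.
case: eqP => // ij; move: (disjointFr AB (rsubset_nth_mem A i)).
by rewrite ij rsubset_nth_mem.
Qed.

Let co := compl_rsubset (addnC s r).

(** The sign of the permutation listing the complement of B and then B, written as a determinant so
    that block identities handle it without counting inversions. *)
Definition shuffle_sign (B : rsubset n s) : K :=
  \det (row_mx (coord_cols (co B)) (coord_cols B)).

Lemma disjoint_compl_rsubset (B : rsubset n s) : [disjoint val (co B) & val B].
Proof. by rewrite -finset.setI_eq0 /= finset.setIC finset.setICr. Qed.

(** Multiplying on the left by the transpose of the matrix that defines the sign gives a block lower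
    triangular matrix whose second diagonal block is the identity. *)
Lemma det_row_coord (M : 'M[K]_(n, r)) (B : rsubset n s) :
  shuffle_sign B * \det (row_mx M (coord_cols B)) =
    \det (rowsub (rsubset_nth (co B)) M).
Proof.
rewrite /shuffle_sign -det_tr -det_mulmx tr_row_mx mul_col_row.
rewrite (coord_cols_disjoint (disjoint_compl_rsubset B)) coord_colsK.
by rewrite det_lblock det1 mulr1 coord_cols_tr.
Qed.

Lemma shuffle_sign_sqr (B : rsubset n s) : shuffle_sign B * shuffle_sign B = 1.
Proof.
rewrite [X in _ * X]/shuffle_sign det_row_coord -coord_cols_tr coord_colsK.
exact: det1.
Qed.

Definition hodge : 'M[K]_(wedge_dim n s, wedge_dim n r) :=
  \matrix_(i, j) (shuffle_sign (enum_val i) *+ (enum_val j == co (enum_val i))).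

Lemma hodgeE (w : 'cV[K]_(wedge_dim n r)) i :
  (hodge *m w) i 0 =
    shuffle_sign (enum_val i) * w (enum_rank (co (enum_val i))) 0.
Proof.
rewrite mxE (bigD1 (enum_rank (co (enum_val i)))) //= big1 ?addr0.
  by rewrite mxE enum_rankK eqxx.
by move=> j; rewrite mxE -(inj_eq enum_val_inj) enum_rankK => /negPf ->; rewrite mul0r.
Qed.

Lemma hodgeK : hodge^T *m hodge = 1%:M.
Proof.
have co_inj : injective co := can_inj (compl_rsubsetK _ (erefl n)).
apply/matrixP => j k; rewrite !mxE.
pose i := enum_rank (compl_rsubset (erefl n) (enum_val j)).
have ij : co (enum_val i) = enum_val j by rewrite enum_rankK /co compl_rsubsetK.
rewrite (bigD1 i) //= big1 ?addr0 => [|l li]; rewrite !mxE.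
  by rewrite ij eqxx mulr1n (inj_eq enum_val_inj) eq_sym mulrnAr shuffle_sign_sqr.
rewrite -ij (inj_eq co_inj) (inj_eq enum_val_inj) eq_sym (negPf li).
by rewrite mul0r.
Qed.

Lemma hodge_trK : hodge *m hodge^T = 1%:M.
Proof.
have co_inj : injective co := can_inj (compl_rsubsetK _ (erefl n)).
apply/matrixP => j k; rewrite !mxE (bigD1 (enum_rank (co (enum_val j)))) //= big1.
  rewrite !mxE enum_rankK eqxx addr0 mulr1n (inj_eq co_inj) (inj_eq enum_val_inj).
  by case: eqP => [->|_]; rewrite ?shuffle_sign_sqr ?mulr0.
by move=> l; rewrite !mxE -(inj_eq enum_val_inj) enum_rankK => /negPf ->; rewrite mul0r.
Qed.

(* Jacobi's complementary minors: multiplying [row_mx M (coord_cols B)] on the *)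
(* left by [col_mx L N^T] makes it block triangular.                           *)
Lemma wedge_cols_hodge (M : 'M[K]_(n, r)) (N : 'M[K]_(n, s)) (L : 'M[K]_(r, n)) :
  L *m M = 1%:M -> N^T *m M = 0 ->
  wedge_cols N = \det (col_mx L N^T) *: (hodge *m wedge_cols M).
Proof.
move=> LM NM; apply/colP => i; rewrite mxE mxE hodgeE mxE enum_rankK.
rewrite -det_row_coord mulrA shuffle_sign_sqr mul1r -det_mulmx mul_col_row.
rewrite LM NM det_ublock det1 mul1r -det_tr -coord_cols_tr trmx_mul.
by rewrite trmxK.
Qed.

(** The columns of [(invmx g)^T *m N] are orthogonal to those of [g *m M], which has left inverse
    [L *m invmx g]. The scalar in [wedge_cols_hodge] for this pair is the one for M and N times det
    g^-1 = 1, and it is nonzero because N has full rank, so it cancels. *)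
Lemma hodge_act (g : 'M[K]_n) (M : 'M[K]_(n, r)) (N : 'M[K]_(n, s)) :
  \det g = 1 -> row_full M -> row_full N -> N^T *m M = 0 ->
  hodge *m (compound r g *m wedge_cols M) =
    compound s (invmx g)^T *m (hodge *m wedge_cols M).
Proof.
move=> g1 /row_fullP [L LM] Nfull NM.
have gU : g \in unitmx by rewrite unitmxE g1 unitr1.
have eN := wedge_cols_hodge LM NM.
have egN : wedge_cols ((invmx g)^T *m N) =
    \det (col_mx L N^T) *: (hodge *m wedge_cols (g *m M)).
  rewrite (@wedge_cols_hodge (g *m M) _ (L *m invmx g)).
  - rewrite trmx_mul trmxK -mul_col_mx det_mulmx; congr (_ *: _).
    by rewrite det_inv g1 invr1 mulr1.
  - by rewrite mulmxA mulmxKV.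
  - by rewrite trmx_mul trmxK mulmxA mulmxKV.
have d0 : \det (col_mx L N^T) != 0.
  by apply: contraNneq (wedge_cols_neq0 Nfull) => d0; rewrite eN d0 scale0r.
apply: (scalerI d0); rewrite -wedge_colsM -egN wedge_colsM eN.
by rewrite -scalemxAr.
Qed.

End Hodge.

Local Open Scope classical_set_scope.

(** * Morphisms induced by linear maps *)

Section Morphism.
Variable K : fieldType.

Lemma morphism_comp (X Y Z : kspace K) (g : Y -> Z) (f : X -> Y) :
  morphism g -> morphism f -> morphism (g \o f).
Proof.
move=> [gc gr] [fc fr]; split=> [x|x u /gr /fr //].
exact: continuous_comp (fc x) (gc (f x)).
Qed.

Lemma morphism_id (X : kspace K) : morphism (@idfun X).
Proof. by split=> // x; exact: cvg_id. Qed.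

Lemma morphism_induced (S S' : choiceType) (X X' : kspace K) (h : S -> X)
    (h' : S' -> X') (F : X -> X') (G : induced h -> induced h') :
  morphism F -> (forall x, h' (G x) = F (h x)) -> morphism G.
Proof.
move=> [/continuousP Fc Fr] hG.
have Gc : continuous G.
  apply/continuousP => _ [B oB <-]; exists (F @^-1` B); first exact: Fc.
  by apply/seteqP; split=> x /=; rewrite hG.
split=> // x g [f fr fg].
exists (f \o F); first by apply: Fr; rewrite -hG.
have gf : \forall y \near x, g (G y) = f (h' (G y)) := Gc _ _ fg.
by apply: filterS gf => y /= ->; rewrite hG.
Qed.

Lemma open_preimage_subbase (X : topologicalType) (T : Type) (F : X -> T)
    (D E : set (set T)) :
  (forall B, D B -> open (F @^-1` B)) -> E `<=` finI_from D id ->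
  open (F @^-1` (\bigcup_(B in E) B)).
Proof.
move=> FD ED; rewrite preimage_bigcup; apply: bigcup_open => _ /ED [D' sD' <-].
rewrite preimage_bigcap bigcap_fset; rewrite big_seq.
elim/big_ind : _ => [|A B|B BD']; [exact: openT|exact: openI|].
by apply: FD; apply/set_mem/sD'.
Qed.

End Morphism.

Section Linear.
Variables (K : fieldType) (m n m' n' : nat).
Variable phi : {linear 'M[K]_(m, n) -> 'M[K]_(m', n')}.

Definition linear_subst (p : mpoly (m' * n') K) : mpoly (m * n) K :=
  comp_mpoly [tuple \sum_k lin_mx phi k i *: mpolyX K (mnm1 k) | i < m' * n'] p.

Lemma peval_linear_subst p A : peval (linear_subst p) A = peval p (phi A).
Proof.
rewrite /peval comp_mpoly_meval; apply: meval_eq => i.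
rewrite tnth_mktuple raddf_sum -mul_vec_lin mxE; apply: eq_bigr => k _.
by rewrite [LHS]mevalZ mevalXU mulrC.
Qed.

Lemma homogeneous_linear_subst d p :
  p \is homogeneous d -> linear_subst p \is homogeneous d.
Proof.
move=> /dhomogP hp; rewrite /linear_subst comp_mpolyE big_seq rpred_sum // => u /hp ud.
have -> : d = (\sum_i u i)%N by rewrite -mdegE.
apply: rpredZ.
have h (s : seq 'I_(m' * n')) (F : 'I_(m' * n') -> mpoly (m * n) K)
    (e : 'I_(m' * n') -> nat) :
    (forall i, F i \is homogeneous (e i)) ->
    \prod_(i <- s) F i \is homogeneous (\sum_(i <- s) e i)%N.
  move=> hF; elim: s => [|i s IHs]; first by rewrite !big_nil dhomog1.
  by rewrite !big_cons; apply: dhomogM.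
apply: h => i; rewrite tnth_mktuple; set l := \sum_k _.
have hl : l \is homogeneous 1.
  by apply: rpred_sum => k _; apply: rpredZ; rewrite dhomogX; apply/eqP; exact: mdeg1.
by have := dhomogMn (u i) hl; rewrite mul1n.
Qed.

Lemma continuous_aff (X : topologicalType) (F : X -> aff K m n) :
  (forall p, open [set x | peval p (aff_mx (F x)) != 0]) -> continuous F.
Proof.
move=> Fp; apply/continuousP => _ [E ED <-].
apply: (@open_preimage_subbase _ _ F _ _ _ ED).
by move=> _ [p _ <-]; exact: Fp.
Qed.

End Linear.

Section LinearMorphism.
Variable K : fieldType.

(** The factor [c ^+ d] is there for projective space, where the chosen coordinates of F x match the
    image of those of x only up to a scalar. It cancels in p / q since both have degree d. *)
Lemma fraction_at_comp (m n m' n' : nat) (S S' : topologicalType)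
    (ev : S -> 'M[K]_(m, n)) (ev' : S' -> 'M[K]_(m', n'))
    (Q : nat -> mpoly (m * n) K -> Prop) (Q' : nat -> mpoly (m' * n') K -> Prop)
    (sg : mpoly (m' * n') K -> mpoly (m * n) K) (F : S -> S') x f :
  continuous F -> (forall d p, Q' d p -> Q d (sg p)) ->
  (forall x, exists2 c, c != 0 &
     forall d p, Q' d p -> peval p (ev' (F x)) = c ^+ d * peval (sg p) (ev x)) ->
  fraction_at ev' Q' (F x) f -> fraction_at ev Q x (f \o F).
Proof.
move=> Fc Qsg evF [d [p [q [Qp Qq qx fpq]]]].
exists d, (sg p), (sg q); split; [exact: Qsg|exact: Qsg| |].
  have [c c0 evc] := evF x; move: qx; rewrite (evc _ _ Qq).
  by apply: contraNneq => ->; rewrite mulr0.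
have fF : \forall y \near x, f (F y) = peval p (ev' (F y)) / peval q (ev' (F y)).
  exact: Fc _ _ fpq.
apply: filterS fF => y /= ->; have [c c0 evc] := evF y.
by rewrite (evc _ _ Qp) (evc _ _ Qq) -mulf_div divff ?mul1r // expf_neq0.
Qed.

Lemma morphism_aff_linear (m n m' n' : nat)
    (phi : {linear 'M[K]_(m, n) -> 'M[K]_(m', n')}) :
  morphism (phi : aff K m n -> aff K m' n').
Proof.
have phi_c : continuous (phi : aff K m n -> aff K m' n').
  apply: continuous_aff => p.
  under [X in open X]eq_set do rewrite -(peval_linear_subst phi).
  exact: aff_ev_open 0%N _ I.
split=> // x f; apply: (fraction_at_comp (sg := linear_subst phi)) => // y.
by exists 1 => [|d p _]; rewrite ?oner_eq0 // expr1n mul1r peval_linear_subst.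
Qed.

Lemma peval_homogeneousZ (m n d : nat) (p : mpoly (m * n) K) c A :
  p \is homogeneous d -> peval p (c *: A) = c ^+ d * peval p A.
Proof.
move=> /dhomogP hp; rewrite /peval !mevalE mulr_sumr big_seq [RHS]big_seq.
apply: eq_bigr => u /hp ud; rewrite mulrCA; congr (_ * _).
have -> : d = (\sum_i u i)%N by rewrite -mdegE.
rewrite -prodrXr -big_split; apply: eq_bigr => i _ /=.
by rewrite linearZ mxE exprMn.
Qed.

Lemma continuous_proj (N : nat) (X : topologicalType) (F : X -> proj K N) :
  (forall d p, p \is homogeneous d -> open [set x | peval p (hcoord (F x)) != 0]) ->
  continuous F.
Proof.
move=> Fp; apply/continuousP => _ [E ED <-].
apply: (@open_preimage_subbase _ _ F _ _ _ ED).
by move=> _ [p [d hp] <-]; exact: Fp hp.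
Qed.

Lemma lineE N (L : proj K N) : val L = <[hcoord L]>%VS.
Proof.
have L1 := eqP (valP L); apply/esym/eqP; rewrite eqEdim L1 dim_vline /hcoord.
by rewrite -memvE memv_pick vpick0 -dimv_eq0 L1.
Qed.

Lemma hcoord_neq0 N (L : proj K N) : hcoord L != 0.
Proof. by rewrite /hcoord vpick0 -dimv_eq0 (eqP (valP L)). Qed.

Section ProjLinear.
Variables (N N' : nat) (phi : {linear 'cV[K]_N -> 'cV[K]_N'}).
Hypothesis phi_inj : injective phi.

Lemma dim_limg_line (L : proj K N) : \dim (linfun phi @: val L)%VS == 1%N.
Proof.
rewrite lineE limg_line dim_vline lfunE /=.
by rewrite (raddf_eq0 _ phi_inj) hcoord_neq0.
Qed.

Definition proj_linear (L : proj K N) : proj K N' :=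
  exist (fun L : {vspace 'cV[K]_N'} => \dim L == 1%N) _ (dim_limg_line L).

Lemma hcoord_proj_linear L :
  exists2 c, c != 0 & hcoord (proj_linear L) = c *: phi (hcoord L).
Proof.
have := memv_pick (val (proj_linear L)); rewrite -/(hcoord _) {2}/proj_linear /=.
rewrite lineE limg_line lfunE /= => /vlineP [c cE]; exists c => //.
have := hcoord_neq0 (proj_linear L); rewrite cE.
by apply: contraNneq => ->; rewrite scale0r.
Qed.

Lemma morphism_proj_linear : morphism proj_linear.
Proof.
have evF L : exists2 c, c != 0 & forall d p, p \is homogeneous d ->
    peval p (hcoord (proj_linear L)) = c ^+ d * peval (linear_subst phi p) (hcoord L).
  have [c c0 cE] := hcoord_proj_linear L; exists c => // d p hp.
  by rewrite cE (peval_homogeneousZ _ _ hp) peval_linear_subst.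
have Fc : continuous proj_linear.
  apply: continuous_proj => d p hp.
  have -> : [set x | peval p (hcoord (proj_linear x)) != 0] =
      [set x | peval (linear_subst phi p) (hcoord x) != 0].
    apply/eq_set => L; have [c c0 evc] := evF L.
    by rewrite (evc _ _ hp) mulf_eq0 expf_eq0 (negPf c0) andbF.
  exact: proj_ev_open (homogeneous_linear_subst phi hp).
split=> // x f; apply: (fraction_at_comp (sg := linear_subst phi)) => //.
by move=> d p; exact: homogeneous_linear_subst.
Qed.

End ProjLinear.
End LinearMorphism.

(** * Uniqueness of categorical quotients *)

Section QuotientTransport.
Variable K : fieldType.

Lemma categorical_quotient_isomorphic (X X' Y Y' : kspace K)
    (orb : X -> X -> Prop) (orb' : X' -> X' -> Prop) (pi : X -> Y) (pi' : X' -> Y')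
    (h : X -> X') (h' : X' -> X) :
  variety Y -> variety Y' ->
  categorical_quotient orb pi -> categorical_quotient orb' pi' ->
  morphism h -> morphism h' -> cancel h h' -> cancel h' h ->
  (forall x y, orb x y -> orb' (h x) (h y)) ->
  (forall x y, orb' x y -> orb (h' x) (h' y)) ->
  isomorphic Y Y'.
Proof.
move=> vY vY' [mpi pio piU] [mpi' pio' piU'] mh mh' hK h'K ho ho'.
have [g [[mg gpi] _]] := piU Y' (pi' \o h) vY' (morphism_comp mpi' mh)
  (fun x y xy => pio' _ _ (ho _ _ xy)).
have [g' [[mg' gpi'] _]] := piU' Y (pi \o h') vY (morphism_comp mpi mh')
  (fun x y xy => pio _ _ (ho' _ _ xy)).
have gE x : g (pi x) = pi' (h x) := congr1 (@^~ x) gpi.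
have g'E x : g' (pi' x) = pi (h' x) := congr1 (@^~ x) gpi'.
exists g; split=> //; exists g'; split=> // [y|y].
  (* Both [g' \o g] and the identity factor [pi] through itself, so uniqueness identifies them. *)
  have [k [_ kU]] := piU Y pi vY mpi pio.
  rewrite -[RHS]/(idfun y) -(kU idfun) ?(kU (g' \o g)) //.
    split; first exact: morphism_comp.
    by apply/funext => x /=; rewrite gE g'E hK.
  by split=> //; exact: morphism_id.
have [k [_ kU]] := piU' Y' pi' vY' mpi' pio'.
rewrite -[RHS]/(idfun y) -(kU idfun) ?(kU (g \o g')) //.
  split; first exact: morphism_comp.
  by apply/funext => x /=; rewrite g'E gE h'K.
by split=> //; exact: morphism_id.
Qed.

End QuotientTransport.

(** * Duality of Grassmannians *)

Section PluckerLinear.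
Variables (K : fieldType) (n : nat) (T : set 'M[K]_n).
Hypothesis T_inv : forall g, T g -> T (invmx g).

(** The intertwining relation is asked only for vectors of the cone, which is where sections
    live. *)
Definition plucker_linear (r s : nat) (theta : Gr K n r -> Gr K n s)
    (psi : 'M[K]_(wedge_dim n s, wedge_dim n r)) : Prop :=
  (forall V, val (plucker (theta V)) = (linfun (mulmx psi) @: val (plucker V))%VS) /\
  forall g V v, T g -> on_plucker_line v V ->
    psi *m wedge_act g v = wedge_act (invmx g) (psi *m v).

Definition sub_map (X X' : kspace K) (A : set X) (A' : set X') (F : X -> X')
    (FA : forall x, A x -> A' (F x)) (x : sub_space A) : sub_space A' :=
  exist (fun y => y \in A') (F (val x)) (mem_set (FA _ (set_mem (valP x)))).

Lemma morphism_sub_map (X X' : kspace K) (A : set X) (A' : set X') (F : X -> X')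
    (FA : forall x, A x -> A' (F x)) : morphism F -> morphism (sub_map FA).
Proof. by move=> mF; apply: (morphism_induced mF). Qed.

Lemma plucker_linear_morphism r s (theta : Gr K n r -> Gr K n s) psi :
  injective (mulmx psi : 'cV_ _ -> _) -> plucker_linear theta psi -> morphism theta.
Proof.
move=> psi_inj [thetaP _]; apply: (morphism_induced (morphism_proj_linear psi_inj)).
by move=> V; apply: val_inj; rewrite /= -thetaP.
Qed.

Lemma on_plucker_line_linear r s (theta : Gr K n r -> Gr K n s) psi v V :
  injective (mulmx psi : 'cV_ _ -> _) -> plucker_linear theta psi ->
  on_plucker_line v V -> on_plucker_line (psi *m v) (theta V).
Proof.
move=> psi_inj [thetaP _] [v0 vV]; split.
  by apply: contraNneq v0 => pv0; apply/eqP/psi_inj; rewrite pv0 mulmx0.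
by rewrite thetaP; apply/memv_imgP; exists v; rewrite ?lfunE.
Qed.

Lemma plucker_linear_inverse r s (theta : Gr K n r -> Gr K n s)
    (theta' : Gr K n s -> Gr K n r) psi psi' :
  psi *m psi' = 1%:M -> psi' *m psi = 1%:M -> cancel theta' theta ->
  plucker_linear theta psi -> plucker_linear theta' psi'.
Proof.
move=> psiK psi'K th'K [thetaP act].
have thetaP' W : val (plucker (theta' W)) = (linfun (mulmx psi') @: val (plucker W))%VS.
  rewrite -{2}(th'K W) thetaP -limg_comp -[LHS]lim1g; congr (_ @: _)%VS.
  by apply/lfunP => v; rewrite comp_lfunE !lfunE /= mulmxA psi'K mul1mx.
split=> // g W v Tg [v0 vW].
(* The relation for [theta] is used at g^-1 and psi' v, then multiplied by psi'. *)
have := act (invmx g) (theta' W) (psi' *m v) (T_inv Tg); rewrite invmxK.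
rewrite [psi *m (psi' *m v)]mulmxA psiK mul1mx => <-; last first.
  split; last by rewrite thetaP'; apply/memv_imgP; exists v; rewrite ?lfunE.
  by apply: contraNneq v0 => pv0; rewrite -[v]mul1mx -psiK -mulmxA pv0 mulmx0.
by rewrite mulmxA psi'K mul1mx.
Qed.

(** An invariant section not vanishing over V is carried to its composite with psi'. Linearity of
    psi' keeps the degree, and invariance under g becomes invariance of the original section under
    g^-1, again in T. *)
Lemma semistable_linear r s m (theta : Gr K n r -> Gr K n s)
    (theta' : Gr K n s -> Gr K n r) psi psi' :
  psi *m psi' = 1%:M -> psi' *m psi = 1%:M ->
  plucker_linear theta psi -> plucker_linear theta' psi' ->
  forall V, semistable T m V -> semistable T m (theta V).
Proof.
move=> psiK psi'K lin lin' V [d [sec [d0 [sec_reg secZ] sec_inv [w [wV sw]]]]].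
have inj : injective (mulmx psi : 'cV_ _ -> _).
  by apply: (can_inj (g := mulmx psi')) => v; rewrite mulmxA psi'K mul1mx.
have inj' : injective (mulmx psi' : 'cV_ _ -> _).
  by apply: (can_inj (g := mulmx psi)) => v; rewrite mulmxA psiK mul1mx.
have cone_psi (v : aff K (wedge_dim n r) 1) :
    @cone K n r v -> @cone K n s (psi *m aff_mx v).
  by move=> [W vW]; exists (theta W); exact: on_plucker_line_linear vW.
have cone_psi' (v : aff K (wedge_dim n s) 1) :
    @cone K n s v -> @cone K n r (psi' *m aff_mx v).
  by move=> [W vW]; exists (theta' W); exact: on_plucker_line_linear vW.
pose F := sub_map (F := mulmx psi' : aff K _ _ -> aff K _ _) cone_psi'.
have mF : morphism F.
  exact: (morphism_sub_map cone_psi' (morphism_aff_linear (mulmx psi'))).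
exists d, (sec \o F); split=> //.
- split=> [x|c v v' c0 vv']; first exact: mF.2 (sec_reg _).
  apply: secZ => //; apply: etrans (esym (scalemxAr _ _ _)).
  exact: (congr1 (mulmx psi')).
- move=> g v v' Tg vv'; have [W vW] := set_mem (valP v).
  apply: (sec_inv (invmx g)); first exact: T_inv.
  by rewrite /= -(lin'.2 _ _ _ Tg vW) -vv'.
pose w' : sub_space (@cone K n s) :=
  sub_map (F := mulmx psi : aff K _ _ -> aff K _ _) cone_psi w.
exists w'; split; first exact: on_plucker_line_linear wV.
have -> // : (sec \o F) w' = sec w.
by congr (sec _); apply: val_inj; rewrite /= mulmxA psi'K mul1mx.
Qed.

Lemma GIT_quotient_linear r s m (theta : Gr K n r -> Gr K n s)
    (theta' : Gr K n s -> Gr K n r) psi psi' Y Y' :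
  psi *m psi' = 1%:M -> psi' *m psi = 1%:M ->
  plucker_linear theta psi -> cancel theta theta' -> cancel theta' theta ->
  (forall V W, same_orbit T V W -> same_orbit T (theta V) (theta W)) ->
  (forall V W, same_orbit T V W -> same_orbit T (theta' V) (theta' W)) ->
  GIT_quotient r T m Y -> GIT_quotient s T m Y' -> isomorphic Y Y'.
Proof.
move=> psiK psi'K lin thK th'K orb orb' [vY [pi [qpi _]]] [vY' [pi' [qpi' _]]].
have lin' := plucker_linear_inverse psiK psi'K th'K lin.
have inj : injective (mulmx psi : 'cV_ _ -> _).
  by apply: (can_inj (g := mulmx psi')) => v; rewrite mulmxA psi'K mul1mx.
have inj' : injective (mulmx psi' : 'cV_ _ -> _).
  by apply: (can_inj (g := mulmx psi)) => v; rewrite mulmxA psiK mul1mx.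
have ss := semistable_linear (m := m) psiK psi'K lin lin'.
have ss' := semistable_linear (m := m) psi'K psiK lin' lin.
apply: (categorical_quotient_isomorphic (h := sub_map ss) (h' := sub_map ss')
  vY vY' qpi qpi').
- exact/morphism_sub_map/(plucker_linear_morphism inj lin).
- exact/morphism_sub_map/(plucker_linear_morphism inj' lin').
- by move=> V; apply: val_inj; rewrite /= thK.
- by move=> V; apply: val_inj; rewrite /= th'K.
- by move=> V W /orb.
- by move=> V W /orb'.
Qed.

End PluckerLinear.

(** * Orthogonal complements for a symmetric form *)

Section Orthogonal.
Variables (K : fieldType) (n : nat).

Lemma mem_gr_basisP r (V : gr_point K n r) (x : 'cV[K]_n) :
  reflect (exists c, x = gr_basis V *m c) (x \in val V).
Proof.
have e : \dim (val V) = r by exact/eqP/(valP V).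
apply: (iffP idP) => [/coord_vbasis xE|[c ->]].
  exists (\col_j coord (vbasis (val V)) (cast_ord (esym e) j) x).
  apply/colP => i; rewrite [in LHS]xE summxE mxE (reindex (cast_ord (esym e))) /=.
    by apply: eq_bigr => j _; rewrite !mxE mulrC.
  by exists (cast_ord e) => j _; rewrite ?cast_ordK ?cast_ordKV.
have -> : gr_basis V *m c = \sum_j c j 0 *: (vbasis (val V))`_j.
  apply/colP => i; rewrite mxE summxE; apply: eq_bigr => j _.
  by rewrite !mxE mulrC.
apply: memv_suml => j _; apply/memvZ/vbasis_mem/mem_nth.
by rewrite size_tuple e.
Qed.

Variable Q : 'M[K]_n.
Hypothesis QU : Q \in unitmx.

Definition orthov r (V : gr_point K n r) : {vspace 'cV[K]_n} :=
  lker (linfun (mulmx ((gr_basis V)^T *m Q) : 'cV_n -> 'cV_r)).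

Lemma mem_orthov r (V : gr_point K n r) y :
  y \in orthov V <-> forall x, x \in val V -> x^T *m Q *m y = 0.
Proof.
rewrite memv_ker lfunE /=; split=> [/eqP yV x /mem_gr_basisP [c ->]|yV].
  by rewrite trmx_mul -!mulmxA [(gr_basis V)^T *m _]mulmxA yV mulmx0.
apply/eqP/row_matrixP => j; rewrite row0 !row_mul -tr_col yV //.
by apply/mem_gr_basisP; exists (delta_mx j 0); rewrite colE.
Qed.

Lemma dim_orthov r s (V : gr_point K n r) : (r + s = n)%N -> \dim (orthov V) == s.
Proof.
move=> rs; rewrite /orthov; set f := linfun _.
have limg_f : limg f = fullv; last first.
  have := limg_ker_dim f fullv.
  rewrite capfv limg_f !dimvf /dim /= !muln1 => dim_f.
  by apply/eqP/(@addnI r); rewrite rs addnC.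
apply/vspaceP => y; rewrite memvf.
have /row_fullP [L LM] := gr_basis_row_full V.
(* Transposing [L *m gr_basis V = 1%:M] shows that [L^T] is a right inverse of the transposed basis
   matrix. *)
apply/memv_imgP; exists (invmx Q *m (L^T *m y)); rewrite ?memvf // lfunE /=.
by rewrite mulmxA mulmxK // mulmxA -trmx_mul LM trmx1 mul1mx.
Qed.

Definition ortho r s (rs : (r + s = n)%N) (V : gr_point K n r) : gr_point K n s :=
  exist (fun W : {vspace 'cV[K]_n} => \dim W == s) _ (dim_orthov V rs).

Hypothesis Q_sym : Q^T = Q.

Lemma orthoK r s (rs : (r + s = n)%N) (sr : (s + r = n)%N) :
  cancel (ortho rs) (ortho sr).
Proof.
move=> V; apply: val_inj; apply/esym/eqP; rewrite eqEdim.
rewrite (eqP (valP V)) (eqP (valP (ortho sr _))) leqnn andbT.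
apply/subvP => x xV; apply/mem_orthov => y /mem_orthov /(_ x xV) xy.
by apply: trmx_inj; rewrite !trmx_mul Q_sym trmxK mulmxA xy trmx0.
Qed.

(** Since g is self-adjoint, z is orthogonal to gV exactly when gz is orthogonal to V. *)
Lemma ortho_act r s (rs : (r + s = n)%N) g (V W : gr_point K n r) :
  g \in unitmx -> g^T *m Q = Q *m g -> val W = gr_act g (val V) ->
  val (ortho rs W) = gr_act (invmx g) (val (ortho rs V)).
Proof.
move=> gU gQ WE; apply/vspaceP => y.
have xgy x z : (g *m x)^T *m Q *m z = x^T *m Q *m (g *m z).
  by rewrite trmx_mul -!mulmxA [g^T *m _]mulmxA gQ !mulmxA.
apply/idP/idP => [/mem_orthov yW|/memv_imgP [z /mem_orthov zV ->]].
  apply/memv_imgP; exists (g *m y); last by rewrite lfunE /= mulKmx.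
  apply/mem_orthov => x xV; rewrite -xgy; apply: yW; rewrite WE.
  by apply/memv_imgP; exists x; rewrite ?lfunE.
apply/mem_orthov => x; rewrite WE => /memv_imgP [u uV ->].
by rewrite !lfunE /= xgy mulKVmx // zV.
Qed.

End Orthogonal.

(** * The complement map as a linear map of Plücker coordinates *)

Section Duality.
Variables (K : fieldType) (r s : nat).
Local Notation n := (r + s)%N.
Variables (T : set 'M[K]_n) (Q : 'M[K]_n).
Hypothesis QU : Q \in unitmx.
Hypothesis Q_sym : Q^T = Q.
Hypothesis T_SL : forall g, T g -> \det g = 1.
Hypothesis T_sym : forall g, T g -> g^T *m Q = Q *m g.

Let theta : Gr K n r -> Gr K n s := ortho QU (erefl n).
(** The star computes the complement for the standard form, which is Q applied to the complement for
    the form of Q; the compound of [invmx Q] undoes this. *)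
Let psi : 'M[K]_(wedge_dim n s, wedge_dim n r) := compound s (invmx Q) *m hodge K r s.
Let psi' : 'M[K]_(wedge_dim n r, wedge_dim n s) := (hodge K r s)^T *m compound s Q.

Lemma psiK : psi *m psi' = 1%:M.
Proof.
rewrite /psi /psi' mulmxA -[_ *m _ *m _^T]mulmxA hodge_trK mulmx1.
by rewrite -compoundM mulVmx // compound1.
Qed.

Lemma psi'K : psi' *m psi = 1%:M.
Proof.
rewrite /psi /psi' mulmxA -[_ *m _ *m compound _ _]mulmxA -compoundM mulmxV //.
by rewrite compound1 mulmx1 hodgeK.
Qed.

Lemma basis_ortho V : (Q *m gr_basis (theta V))^T *m gr_basis V = 0.
Proof.
apply: trmx_inj; rewrite trmx_mul trmxK trmx0 mulmxA.
apply/matrixP => i j; rewrite [in RHS]mxE.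
have : col j (gr_basis (theta V)) \in val (theta V).
  by apply/mem_gr_basisP; exists (delta_mx j 0); rewrite colE.
rewrite memv_ker lfunE /= => /eqP; rewrite colE mulmxA -colE => /colP /(_ i).
by rewrite mxE [in RHS]mxE.
Qed.

Lemma row_full_basis_ortho V : row_full (Q *m gr_basis (theta V)).
Proof.
by rewrite /row_full eqmxMfull ?row_full_unit //; exact: gr_basis_row_full.
Qed.

Lemma plucker_theta V :
  val (plucker (theta V)) = (linfun (mulmx psi) @: val (plucker V))%VS.
Proof.
rewrite /= limg_line lfunE /=.
have /row_fullP [L LM] := gr_basis_row_full V.
have := wedge_cols_hodge LM (basis_ortho V); set d := \det _ => wE.
have {}wE : wedge_cols (gr_basis (theta V)) = d *: (psi *m wedge_cols (gr_basis V)).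
  rewrite -mulmxA scalemxAr -wE wedge_colsM mulmxA -compoundM mulVmx //.
  by rewrite compound1 mul1mx.
have d0 : d != 0.
  by apply: contraNneq (wedge_cols_neq0 (gr_basis_row_full (theta V))) => d0;
    rewrite wE d0 scale0r.
apply/eqP; rewrite eqEsubv -!memvE wE memvZ ?memv_line //=.
by apply/vlineP; exists d^-1; rewrite scalerA mulVf // scale1r.
Qed.

Lemma psi_act g V v : T g -> on_plucker_line v V ->
  psi *m wedge_act g v = wedge_act (invmx g) (psi *m v).
Proof.
move=> Tg [_ /vlineP [c ->]].
have gU : g \in unitmx by rewrite unitmxE T_SL // unitr1.
set w := wedge_cols _.
change (psi *m (compound r g *m (c *: w)) = compound s (invmx g) *m (psi *m (c *: w))).
rewrite -!scalemxAr; congr (_ *: _).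
rewrite -mulmxA (hodge_act (T_SL Tg) (gr_basis_row_full V)
  (row_full_basis_ortho V) (basis_ortho V)).
rewrite -[psi *m _]mulmxA !mulmxA -!compoundM; congr (compound s _ *m _ *m _).
(* What remains, [invmx Q *m (invmx g)^T = invmx g *m invmx Q], is the inverse of
   self-adjointness. *)
apply: (canRL (mulmxK QU)); rewrite -[RHS]mul1mx; apply: (canRL (mulmxK gU)).
by rewrite -mulmxA -T_sym // mulmxA trmx_inv mulmxKV ?unitmx_tr // mulVmx.
Qed.

End Duality.

Lemma GIT_quotient_dual (K : fieldType) (r s m : nat) (T : set 'M[K]_(r + s))
    (Q : 'M[K]_(r + s)) Y Y' :
  Q \in unitmx -> Q^T = Q -> (forall g, T g -> \det g = 1) ->
  (forall g, T g -> T (invmx g)) -> (forall g, T g -> g^T *m Q = Q *m g) ->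
  GIT_quotient r T m Y -> GIT_quotient s T m Y' -> isomorphic Y Y'.
Proof.
move=> QU Q_sym T_SL T_inv T_sym.
have T_unit g : T g -> g \in unitmx by move=> /T_SL g1; rewrite unitmxE g1 unitr1.
apply: (GIT_quotient_linear T_inv (psiK QU) (psi'K QU)
  (theta := ortho QU (erefl _)) (theta' := ortho QU (addnC s r))).
- split=> [V|g V v Tg vV]; first exact: plucker_theta.
  exact: (psi_act QU T_SL T_sym Tg vV).
- exact: orthoK.
- exact: orthoK.
- by move=> V W [g Tg WE]; exists (invmx g); [exact: T_inv|apply: ortho_act => //; auto].
- by move=> V W [g Tg WE]; exists (invmx g); [exact: T_inv|apply: ortho_act => //; auto].
Qed.

(** * Tori consist of self-adjoint matrices *)

Section RootsOfUnity.
Variable K : numClosedFieldType.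

Lemma Xn_sub_1_split m : (0 < m)%N ->
  exists2 rs : seq K, uniq rs & 'X^m - 1 = \prod_(x <- rs) ('X - x%:P).
Proof.
move=> m0; have [rs rsE] := closed_field_poly_normal ('X^m - 1 : {poly K}).
have {}rsE : 'X^m - 1 = \prod_(x <- rs) ('X - x%:P).
  by rewrite {1}rsE (eqP (monic_Xn_sub_1 K m0)) scale1r.
exists rs => //; rewrite -separable_prod_XsubC -rsE.
by apply: separable_Xn_sub_1; rewrite pnatr_eq0 -lt0n.
Qed.

(** For m = [size q], the polynomial X^m - 1 has m distinct roots, one more than the degree of q. *)
Lemma root_of_unity_nonroot (q : {poly K}) : q != 0 ->
  exists z, (exists2 m, (0 < m)%N & z ^+ m = 1) /\ q.[z] != 0.
Proof.
move=> q0; have m0 : (0 < size q)%N by rewrite size_poly_gt0.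
have [rs rsU rsE] := Xn_sub_1_split m0.
have size_rs : size rs = size q.
  by apply: succn_inj; rewrite -(size_prod_XsubC _ id) -rsE size_Xn_sub_1.
have /allPn [z zrs qz] : ~~ all (root q) rs.
  by apply: contraTN isT => /(max_poly_roots q0)/(_ rsU); rewrite size_rs ltnn.
exists z; split=> //; exists (size q) => //.
have : root ('X^(size q) - 1) z by rewrite rsE root_prod_XsubC.
by rewrite rootE !hornerE subr_eq0 => /eqP.
Qed.

(** Density of torsion points: the coordinates of a are replaced by roots of unity one at a time,
    each step being a question about a nonzero polynomial in one variable. *)
Lemma root_of_unity_meval_neq0 N (p : mpoly N K) (a : 'I_N -> K) : meval a p != 0 ->
  exists b : 'I_N -> K,
    (forall i, exists2 m, (0 < m)%N & b i ^+ m = 1) /\ meval b p != 0.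
Proof.
move=> pa; suff [b [b1 pb]] : exists b : 'I_N -> K,
    (forall i, i \in enum 'I_N -> exists2 m, (0 < m)%N & b i ^+ m = 1) /\
    meval b p != 0.
  by exists b; split=> // i; apply: b1; rewrite mem_enum.
elim: (enum 'I_N) => [|j l [b [b1 pb]]]; first by exists a.
pose c z i := if i == j then z else b i.
pose q := mmap (@polyC K) (fun i => if i == j then 'X else (b i)%:P) p.
have qE z : q.[z] = meval (c z) p.
  rewrite mevalE /q /mmap horner_sum; apply: eq_bigr => u _.
  rewrite hornerM hornerC; congr (_ * _); rewrite horner_prod; apply: eq_bigr => i _.
  by rewrite /c horner_exp; case: eqP => _; rewrite ?hornerX ?hornerC.
have q0 : q != 0.
  apply: contraNneq pb => q0; have := qE (b j); rewrite q0 horner0 => /esym <-.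
  by apply/eqP/meval_eq => i; rewrite /c; case: eqP => // ->.
have [z [z1 qz]] := root_of_unity_nonroot q0.
exists (c z); rewrite -qE; split=> // i; rewrite inE /c.
by case: eqP => //= _; exact: b1.
Qed.

(** The minimal polynomial divides X^m - 1, which splits with simple roots. *)
Lemma diagonalizable_finite_order n (g : 'M[K]_n.+1) m :
  (0 < m)%N -> g ^+ m = 1 -> diagonalizable g.
Proof.
move=> m0 gm; apply/diagonalizableP; have [rs rsU rsE] := Xn_sub_1_split m0.
exists rs => //; rewrite -rsE; apply: mxminpoly_min.
by rewrite rmorphB rmorph1 rmorphXn /= horner_mx_X gm subrr.
Qed.

End RootsOfUnity.

Section Span.
Variables (K : fieldType) (vT : vectType K) (A : set vT).

(** A finite family in A whose span has maximal dimension works. It allows simultaneous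
    diagonalization, available for finite families, to reach all torsion points. *)
Lemma finite_spanning_seq :
  exists s : seq vT, (forall x, x \in s -> A x) /\ (forall x, A x -> x \in <<s>>%VS).
Proof.
pose P d := `[< exists s : seq vT, (forall x, x \in s -> A x) /\ \dim <<s>> = d >].
have P0 : exists d, P d.
  by exists (\dim <<[::] : seq vT>>); apply/asboolP; exists [::].
have Pmax d : P d -> (d <= \dim {:vT})%N.
  by move=> /asboolP [s [_ <-]]; apply: dimvS; exact: subvf.
case: (ex_maxnP P0 Pmax) => d /asboolP [s [sA sd]] dmax.
exists s; split=> // x Ax.
have : (\dim <<x :: s>> <= d)%N.
  apply: dmax; apply/asboolP; exists (x :: s); split=> // y.
  by rewrite inE => /orP [/eqP ->|/sA].
rewrite -sd => dxs; have : (<<s>> == <<x :: s>>)%VS.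
  by rewrite eqEdim dxs andbT span_cons addvSr.
by move=> /eqP ->; rewrite memv_span ?mem_head.
Qed.

End Span.

(** * From torsion points to the whole torus *)

Section Torus.
Variable K : numClosedFieldType.

Lemma finI_from_seq (S : Type) (D E : set (set S)) a :
  E `<=` finI_from D id -> (\bigcup_(B in E) B) a ->
  exists l : seq (set S), (forall C, C \in l -> D C /\ C a) /\
    forall b, (forall C, C \in l -> C b) -> (\bigcup_(B in E) B) b.
Proof.
move=> ED [B EB Ba]; have [D' sD' BE] := ED _ EB.
exists D'; split=> [C CD'|b D'b].
  by split; [apply/set_mem/sD'|move: Ba; rewrite -BE; exact].
by exists B => //; rewrite -BE => C; exact: D'b.
Qed.

Lemma aff_open_nbhs m n (O : set (aff K m n)) a : open O -> O a ->
  exists p, peval p (aff_mx a) != 0 /\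
    forall b : aff K m n, peval p (aff_mx b) != 0 -> O b.
Proof.
move=> [E ED <-] /(finI_from_seq ED) [l [lD lO]].
suff [p [pa pl]] : exists p, peval p (aff_mx a) != 0 /\
    forall b : aff K m n, peval p (aff_mx b) != 0 -> forall C, C \in l -> C b.
  by exists p; split=> // b /pl; exact: lO.
elim: l lD {lO} => [|C l IHl] lD.
  by exists (mpolyC _ 1); rewrite pevalC oner_eq0.
have [|p [pa pl]] := IHl.
  by move=> B Bl; apply: lD; rewrite inE Bl orbT.
have [[q _ qC] Ca] := lD C (mem_head _ _).
exists (q * p); split.
  by rewrite pevalM mulf_neq0 //; move: Ca; rewrite -qC.
move=> b; rewrite pevalM mulf_eq0 negb_or => /andP [qb pb] B.
by rewrite inE => /orP [/eqP -> |/(pl _ pb)//]; rewrite -qC.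
Qed.

(* The torsion points of the torus are finite-order matrices, hence            *)
(* simultaneously diagonalised by some P, and Q := P^T *m P makes them         *)
(* self-adjoint.  Self-adjointness is a Zariski-closed condition and the       *)
(* torsion points are dense.                                                   *)
Lemma torus_symmetric n (T : set 'M[K]_n) : torus T ->
  exists Q, [/\ Q \in unitmx, Q^T = Q & forall g, T g -> g^T *m Q = Q *m g].
Proof.
case: n T => [|n] T.
  move=> _; exists 1%:M; split; rewrite ?unitmx1 ?trmx1 // => g _.
  by apply/matrixP => [[]].
move=> [[T_SL T1 TM TV] _ [k [phi [[[phi_c _] [phi' [_ _ phi'K]]] phiM]]]].
pose rho u := val (phi u).
have rhoM u v w :
    (forall i, aff_mx (val w) i 0 = aff_mx (val u) i 0 * aff_mx (val v) i 0) ->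
    rho w = rho u * rho v := phiM u v w.
have rhoT u : T (rho u) := set_mem (valP (phi u)).
have rho_onto g : T g -> exists u, rho u = g.
  move=> Tg; exists (phi' (exist (fun g => g \in T) g (mem_set Tg))).
  by rewrite /rho phi'K.
have gm (c : 'I_k -> K) : (forall i, c i != 0) ->
    exists u : Gm K k, forall i, aff_mx (val u) i 0 = c i.
  move=> c0; have cG : \col_i c i \in [set a : aff K k 1 | forall i, aff_mx a i 0 != 0].
    by apply/mem_set => i; rewrite /aff_mx mxE.
  by exists (exist _ (\col_i c i : aff K k 1) cG) => i; rewrite /aff_mx mxE.
have gm0 (u : Gm K k) i : aff_mx (val u) i 0 != 0 := set_mem (valP u) i.
have rho_unit u : rho u \is a GRing.unit.
  by rewrite unitmxE (T_SL _ (rhoT u)) unitr1.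
have rho1 u : (forall i, aff_mx (val u) i 0 = 1) -> rho u = 1.
  move=> u1; apply: (mulrI (rho_unit u)); rewrite mulr1 -(rhoM _ _ u) // => i.
  by rewrite u1 mulr1.
have rhoX m u v : (forall i, aff_mx (val v) i 0 = aff_mx (val u) i 0 ^+ m) ->
    rho v = rho u ^+ m.
  elim: m v => [|m IHm] v vu; first by rewrite rho1 // => i; rewrite vu.
  have [w wE] := gm (fun i => aff_mx (val u) i 0 ^+ m) (fun i => expf_neq0 m (gm0 u i)).
  by rewrite exprS -(IHm w) //; apply: rhoM => i; rewrite vu wE exprS.
have rhoC u v : rho u *m rho v = rho v *m rho u.
  have [w wE] := gm _ (fun i => mulf_neq0 (gm0 u i) (gm0 v i)).
  have -> : rho u *m rho v = rho w by rewrite (rhoM u v w).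
  by rewrite (rhoM v u w) // => i; rewrite wE mulrC.
pose A : set 'M[K]_n.+1 := [set g | exists u m, [/\ (0 < m)%N,
  forall i, aff_mx (val u) i 0 ^+ m = 1 & rho u = g]].
have [s [sA As]] := finite_spanning_seq A.
have [P PU sP] : codiagonalizable s.
  apply/codiagonalizableP; split=> [_ _ /sA [u [_ [_ _ <-]]] /sA [v [_ [_ _ <-]]]|].
    exact: rhoC.
  move=> _ /sA [u [m [m0 u1 <-]]]; apply: (diagonalizable_finite_order m0).
  have [w wE] := gm (fun=> 1) (fun=> oner_neq0 K).
  by rewrite -(rhoX _ _ w) ?rho1 // => i; rewrite wE u1.
pose Q := P^T *m P; exists Q; split.
- by rewrite unitmx_mul unitmx_tr PU.
- by rewrite trmx_mul trmxK.
(* [E] measures the failure of self-adjointness. Being linear, it vanishes on all torsion points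
   once it vanishes on the spanning family. *)
pose E : 'Hom('M[K]_n.+1, 'M[K]_n.+1) :=
  (linfun (mulmxr Q) \o linfun trmx - linfun (mulmx Q))%VF.
have EE g : E g = g^T *m Q - Q *m g.
  by rewrite add_lfunE opp_lfunE comp_lfunE !lfunE.
have Es g : g \in s -> E g = 0.
  move=> gs; have := allP sP _ gs => /(similar_diagLR PU) [D ->].
  (* With g = P^-1 D P and D diagonal, both products equal P^T D P. *)
  rewrite EE conjumx ?unitmx_inv // invmxK /Q !trmx_mul tr_diag_mx.
  by rewrite trmx_inv !mulmxA mulmxK // mulmxKV ?unitmx_tr // subrr.
have EA g : A g -> E g = 0.
  move=> /As; have /span_subvP sub : {subset s <= lker E}.
    by move=> x /Es Ex; rewrite memv_ker Ex.
  by move=> /(subvP sub); rewrite memv_ker => /eqP.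
move=> _ /rho_onto [u <-]; apply/subr0_eq; rewrite -EE.
apply/matrixP => i j; rewrite [in RHS]mxE; apply/eqP; apply: contraT => Eu.
pose p := linear_subst E (mpolyX K (mnm1 (mxvec_index i j))).
have pE g : peval p g = E g i j.
  by rewrite peval_linear_subst /peval mevalXU mxvecE.
have : open [set v : Gm K k | peval p (rho v) != 0].
  have := @aff_ev_open K n.+1 n.+1 0%N p I.
  move: phi_c => /continuousP phi_o op.
  apply: (phi_o [set g | peval p (aff_mx (val g)) != 0]).
  by exists [set g | peval p (aff_mx g) != 0].
move=> [O oO OE]; have Ou : O (val u).
  by have : [set v : Gm K k | peval p (rho v) != 0] u by [rewrite /= pE]; rewrite -OE.
have [q [qu qO]] := aff_open_nbhs oO Ou.
have [b [b1 qb]] := root_of_unity_meval_neq0 qu.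
have b0 i' : b (mxvec_index i' 0) != 0.
  have [m m0 bm] := b1 (mxvec_index i' 0).
  by apply: contra_eq_neq bm => ->; rewrite expr0n gtn_eqF // eq_sym oner_neq0.
have [t tE] := gm _ b0.
have Ot : O (val t).
  apply: qO; rewrite /peval (meval_eq (v2 := b)) // => l.
  by case/mxvec_indexP: l => i' j'; rewrite mxvecE ord1 tE.
have : [set v : Gm K k | peval p (rho v) != 0] t by rewrite -OE.
rewrite /= pE EA ?mxE ?eqxx //.
(* The product of exponents killing the single coordinates kills all of them, so t is a torsion
   point. *)
have /fin_all_exists2 [m m0 bm] i' :
    exists2 m, (0 < m)%N & b (mxvec_index i' 0) ^+ m = 1.
  exact: b1.
exists t, (\prod_i' m i')%N; split=> // [|i'].
  by rewrite prodn_gt0.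
by rewrite tE (bigD1 i') //= exprM bm expr1n.
Qed.

End Torus.

Theorem proposition5p1 (R : realType) (n r : nat) (T : set 'M[R[i]]_n)
    (Y Y' : kspace R[i]) :
  (1 <= r <= n - 1)%N ->
  maximal_torus T ->
  GIT_quotient r T n Y ->
  GIT_quotient (n - r) T n Y' ->
  isomorphic Y Y'.
Proof.
move=> /andP [_ rn] [torusT _].
have [Q [QU Q_sym QT]] := torus_symmetric torusT.
case: torusT => [[T_SL _ _ T_inv] _ _].
have rs : n = (r + (n - r))%N by rewrite subnKC // (leq_trans rn) ?leq_subr.
(* The dimension is put in the form r + s, as the block matrices of the Hodge star require. *)
move: (n - r)%N rs => s rs; subst n.
exact: (GIT_quotient_dual QU Q_sym T_SL T_inv QT).
Qed.
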